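(* Let $l\ge 1$ be fixed, and let $a,b\geq1$, $j\geq0$ and $n\ge 1$ be integers with $a+b+1=l(n-j)$. Then $$\sum_{i\geq0}h_{i}\,Q_{n-i,a,j}=\sum_{i\geq0}h_i\,Q_{n-i,b,j},$$ where $h_i$ is the complete homogeneous symmetric function of degree $i$ (with $h_0=1$) and $Q_{m,k,j}$ is the flag Eulerian quasisymmetric function described in the context (with $Q_{m,k,j}=0$ for $m<0$).
   Context: Fix a positive integer $l$ and commuting indeterminates $x_1,x_2,\dots$. Let $\mathcal{B}$ be the alphabet consisting of the letters $u^m$ ($u\in\{1,2,\dots\}$, $m\in\{0,1,\dots,l-1\}$) and the barred letters $\overline{u^0}$ ($u\in\{1,2,\dots\}$). The letter $u^m$ is called $m$-colored; the barred letter $\overline{u^0}$ is called $0$-colored. The absolute value of $u^m$ and of $\overline{u^0}$ is $u$, and the weight of each of these letters is $x_u$. A colored necklace is a circular word over $\mathcal{B}$ (letters placed clockwise on a circle, considered up to rotation) which is primitive (the underlying linear word is not of the form $w'w'\cdots w'$ with at least two copies of a proper subword $w'$) and satisfies: (1) every barred letter is followed (clockwise) by a letter of lesser or equal absolute value; (2) every $0$-colored unbarred letter is followed by a letter of greater or equal absolute value; (3) a necklace of length one does not consist of a single barred letter. A colored ornament is a finite multiset of colored necklaces; its weight $\mathrm{wt}(R)$ is the product of the weights of all its letters. For integers $n,k,j\ge0$, the flag Eulerian quasisymmetric function $Q_{n,k,j}$ is the sum of $\mathrm{wt}(R)$ over all colored ornaments $R$ having $n$ letters in total, exactly $j$ necklaces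 that consist of a single letter of the form $u^0$, and such that $l\cdot(\text{number of barred letters of }R)+\sum_{m=1}^{l-1} m\cdot(\text{number of letters of }R\text{ of the form }u^m)=k$. (By Hyatt's colored ornament interpretation this coincides with the paper's definition of $Q_{n,k,j}$ as a sum of the fixed point colored Eulerian quasisymmetric functions $Q_{n,i,\vec\alpha,\vec\beta}$ over $li+\sum_m m\beta_m=k$, $\alpha_0=j$.) In particular $Q_{0,0,0}=1$. *)

(* Defs.v *)
From HB Require Import structures.
From mathcomp Require Import all_boot all_order all_algebra.
From mathcomp Require Import mpoly.
Set Implicit Arguments. Unset Strict Implicit. Unset Printing Implicit Defensive.
Import GRing.Theory.
Local Open Scope ring_scope.

(* We work with the truncation to the variables x_1, ..., x_N, realised as
   'X_0, ..., 'X_(N-1) in {mpoly int[N]}.  A letter with absolute value u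
   (1 <= u <= N) is encoded with first component the ordinal u-1.

   letter N l := 'I_N * option 'I_l
     (u, Some m) = the unbarred letter u^m   (m-colored)
     (u, None)   = the barred letter  \overline{u^0}  (0-colored). *)
Definition letter (N l : nat) := ('I_N * option 'I_l)%type.

Section Letters.
Variables N l : nat.
Implicit Types (x : letter N l) (w : seq (letter N l)).

Definition absv x : nat := (x.1 : nat).+1.
Definition barred x : bool := x.2 == None.
Definition zero_unbarred x : bool := if x.2 is Some m then (m : nat) == 0%N else false.
Definition colstat x : nat := if x.2 is Some m then (m : nat) else l.

Definition primitive w : bool :=
  ~~ [exists d : 'I_(size w).+1,
        (1 < d)%N && (w == flatten (nseq d (take (size w %/ d) w)))].

(* circular conditions (1),(2),(3); each letter is followed clockwise by the
   next one, the last letter by the first one. *)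
Definition circ_ok w : bool :=
  all (fun xy : letter N l * letter N l =>
         (barred xy.1 ==> (absv xy.2 <= absv xy.1)%N) &&
         (zero_unbarred xy.1 ==> (absv xy.1 <= absv xy.2)%N))
      (zip w (rot 1 w))
  && ((size w != 1%N) || all (fun x => ~~ barred x) w).
End Letters.

Section Ornaments.
Variables N l n : nat.

Definition word := {k : 'I_n.+1 & k.-tuple (letter N l)}.
Definition wseq (v : word) : seq (letter N l) := tagged v.

(* the circular word (necklace) represented by w: the set of its rotations *)
Definition rotclass (w : seq (letter N l)) : {set word} :=
  [set v : word | wseq v \in [seq rot i w | i <- iota 0 (size w)]].

Definition is_necklace (S : {set word}) : bool :=
  [exists v : word, [&& (0 < size (wseq v))%N, primitive (wseq v),
                        circ_ok (wseq v) & S == rotclass (wseq v)]].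

Definition word0 : word := existT _ ord0 [tuple].
Definition rep (S : {set word}) : seq (letter N l) :=
  wseq (odflt word0 [pick v in S]).

(* ornaments with n letters: finite multisets of necklaces, encoded by their
   multiplicity function (multiplicities are necessarily <= n) *)
Definition ornament := {ffun {set word} -> 'I_n.+1}.

Definition is_ornament (R : ornament) : bool :=
  [forall S, ((R S : nat) != 0%N) ==> is_necklace S].

Definition nletters (R : ornament) : nat :=
  (\sum_(S : {set word}) R S * size (rep S))%N.

Definition kstat (R : ornament) : nat :=
  (\sum_(S : {set word}) R S * \sum_(x <- rep S) @colstat N l x)%N.

Definition single_u0 (S : {set word}) : bool :=
  (size (rep S) == 1%N) && all (@zero_unbarred N l) (rep S).
Definition jstat (R : ornament) : nat :=
  (\sum_(S : {set word} | single_u0 S) R S)%N.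

Definition wt (R : ornament) : {mpoly int[N]} :=
  \prod_(S : {set word}) (\prod_(x <- rep S) 'X_(x.1)) ^+ R S.
End Ornaments.

Definition Qflag (N l n k j : nat) : {mpoly int[N]} :=
  \sum_(R : ornament N l n | [&& is_ornament R, nletters R == n,
                                 kstat R == k & jstat R == j]) wt R.

Definition hcomp (N i : nat) : {mpoly int[N]} :=
  \sum_(m : 'X_{1..N < i.+1} | mdeg m == i) 'X_[m].

(* Main.v *)
Require Import Defs.
From HB Require Import structures.
From mathcomp Require Import all_boot all_order all_algebra.
From mathcomp Require Import mpoly ring zify.
Set Implicit Arguments. Unset Strict Implicit. Unset Printing Implicit Defensive.
Import GRing.Theory.
Local Open Scope ring_scope.

(* Write H(z), E(z) for the series sum h_i z^i and prod (1 - x_u z), and let r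
   mark the necklaces u^0.  Necklaces are the primitive closed walks of a
   digraph on the letters, so the ornament series P is an Euler product; its
   logarithmic derivative is sum_k tr(M^k) z^k, up to the contribution of the
   one-letter necklaces that are excluded or marked by r.  Jacobi's formula gives
   det(1 - zM) the opposite logarithmic derivative, whence
     P det(1 - zM) E(rz) = E(z) E(t^l z),
     (1 - t) det(1 - zM) = E(z) - t E(t^l z).
   Hence the coefficient of r^j in F = H(z) P is h_j z^j F_0 with
   F_0 det(1 - zM) = E(t^l z), and t F_0 + 1 - t = E(z) / det(1 - zM).
   The coefficient of z^k in det(1 - zM) is invariant under p |-> t^(lk) p(1/t),
   which exchanges those of E(z) and E(t^l z); so for k > 0 the coefficient of z^k
   in F_0 is sent to t times itself, which is the symmetry a <-> lk - 1 - a. *)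

(** * Logarithmic derivatives of truncated power series *)

Section TruncatedSeries.
Variables (R : comNzRingType) (n : nat).
Implicit Types p q L K : {poly R}.

(** Congruence modulo ['X^(n.+1)]: a power series is represented by any polynomial with the right
    coefficients up to degree [n]. *)
Definition eqmodX p q := forall k, (k <= n)%N -> p`_k = q`_k.

Lemma eqmodX_refl p : eqmodX p p. Proof. by []. Qed.

Lemma eqmodX_sym p q : eqmodX p q -> eqmodX q p.
Proof. by move=> pq k kn; rewrite pq. Qed.

Lemma eqmodX_trans q p p' : eqmodX p q -> eqmodX q p' -> eqmodX p p'.
Proof. by move=> pq qp k kn; rewrite pq ?qp. Qed.

Lemma eqmodXD p p' q q' : eqmodX p p' -> eqmodX q q' -> eqmodX (p + q) (p' + q').
Proof. by move=> pp qq k kn; rewrite !coefD pp ?qq. Qed.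

Lemma eqmodXN p q : eqmodX p q -> eqmodX (- p) (- q).
Proof. by move=> pq k kn; rewrite !coefN pq. Qed.

Lemma eqmodXM p p' q q' : eqmodX p p' -> eqmodX q q' -> eqmodX (p * q) (p' * q').
Proof.
move=> pp qq k kn; rewrite !coefM; apply: eq_bigr => i _.
by rewrite pp ?qq // (leq_trans _ kn) ?leq_subr // -ltnS.
Qed.

Lemma eqmodXMl p q q' : eqmodX q q' -> eqmodX (p * q) (p * q').
Proof. exact/eqmodXM/eqmodX_refl. Qed.

Lemma eqmodXMr p q q' : eqmodX q q' -> eqmodX (q * p) (q' * p).
Proof. by move=> /eqmodXM; apply; apply: eqmodX_refl. Qed.

(* Euler's derivation z d/dz, which unlike d/dz is compatible with truncation. *)
Definition theta p : {poly R} := 'X * p^`().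

Lemma coef_theta p k : (theta p)`_k = p`_k *+ k.
Proof.
rewrite /theta coefXM; case: k => [|k] /=; first by rewrite mulr0n.
by rewrite coef_deriv.
Qed.

Lemma thetaM p q : theta (p * q) = theta p * q + p * theta q.
Proof. by rewrite /theta derivM mulrDr mulrA; congr (_ + _); rewrite mulrCA. Qed.

(** [L] is the logarithmic derivative [theta p / p], written without division. *)
Definition logder p L := eqmodX (theta p) (L * p).

Lemma logderM p q L K : logder p L -> logder q K -> logder (p * q) (L + K).
Proof.
move=> pL qK; rewrite /logder thetaM mulrDl; apply: eqmodXD.
  by rewrite mulrA; apply: eqmodXMr.
by rewrite [K * _]mulrCA; apply: eqmodXMl.
Qed.

Lemma logder1 : logder 1 0.
Proof. by rewrite /logder /theta derivC mulr0 mul0r; apply: eqmodX_refl. Qed.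

Lemma logder_prod (I : finType) (P : pred I) (p L : I -> {poly R}) :
  (forall i, P i -> logder (p i) (L i)) ->
  logder (\prod_(i | P i) p i) (\sum_(i | P i) L i).
Proof.
move=> pL; apply: (big_ind2 (fun q K => logder q K)) => //; first exact: logder1.
by move=> q K q' K'; apply: logderM.
Qed.

Lemma logder_congr p L K : eqmodX L K -> logder p L -> logder p K.
Proof. by move=> LK; move/eqmodX_trans; apply; apply: eqmodXMr. Qed.

(** Since [L_0 = 0], the product [k p_k] is the sum of [L_i p_(k-i)] over [i > 0]. So the lower
    coefficients determine [p_k], torsion-freeness allowing division by [k]. *)
Lemma logder_uniq p q L :
    (forall (x : R) k, x *+ k.+1 = 0 -> x = 0) ->
  L`_0 = 0 -> p`_0 = q`_0 -> logder p L -> logder q L -> eqmodX p q.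
Proof.
move=> Rtf L0 pq0 pL qL; elim/ltn_ind=> -[_ _|k IH kn] //.
apply/eqP; rewrite -subr_eq0; apply/eqP/(Rtf _ k); rewrite mulrnBl.
rewrite -!coef_theta pL // qL // !coefM -sumrB big_ord_recl L0 !mul0r subrr add0r.
apply: big1 => i _; rewrite IH ?subrr //.
  by rewrite lift0 subSS ltnS leq_subr.
by rewrite (leq_trans (leq_subr _ _)).
Qed.

(** * Geometric series *)

Section Geometric.
Variables (d : nat) (c : R).
Hypothesis d_gt0 : (0 < d)%N.
Let a : {poly R} := c *: 'X^d.

(** The inverse of [1 - c z^d] up to degree [n]. The exponents [i <= n] later become the
    multiplicities of a necklace in an ornament. *)
Definition geom : {poly R} := \sum_(i < n.+1) (c *: 'X^d) ^+ i.

Lemma geomE : eqmodX ((1 - a) * geom) 1.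
Proof.
have -> : (1 - a) * geom = 1 - a ^+ n.+1.
  by rewrite -opprB mulNr -subrX1 opprB.
move=> k kn; rewrite coefB /a exprZn -exprM coefZ coefXn.
rewrite (ltn_eqF (leq_trans (kn : (k < n.+1)%N) _)) ?mulr0 ?subr0 //.
by rewrite leq_pmull.
Qed.

Definition geomlog : {poly R} := geom * a *+ d.

Lemma coef_geomlog k : (k <= n)%N ->
  geomlog`_k = if (0 < k)%N && (d %| k)%N then c ^+ (k %/ d) *+ d else 0.
Proof.
move=> kn; rewrite /geomlog coefMn /geom mulr_suml coef_sum.
under eq_bigr => i _ do
  rewrite -exprSr exprZn -exprM coefZ coefXn.
case: ifP => [/andP[k0 /dvdnP[e ke]]|kd].
  have e0 : (0 < e)%N by move: k0; rewrite ke muln_gt0 => /andP[].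
  have en : (e.-1 < n.+1)%N.
    by rewrite prednK // (leq_trans _ (leqW kn)) // ke leq_pmulr.
  rewrite ke mulnK // (bigD1 (Ordinal en)) //= prednK // mulnC eqxx mulr1.
  rewrite big1 ?addr0 // => i ie; rewrite eqn_pmul2l //.
  case: eqP => [ei|]; last by rewrite mulr0.
  by case/eqP: ie; apply: val_inj; rewrite /= ei.
rewrite big1 ?mul0rn // => i _; case: eqP => [ki|]; last by rewrite mulr0.
by move/negP: kd; rewrite ki dvdn_mulr // muln_gt0 d_gt0.
Qed.

Lemma theta_monomial : theta a = a *+ d.
Proof.
by rewrite /theta /a derivZ derivXn -scalerAr mulrnAr -exprS prednK // scalerMnr.
Qed.

Lemma logder_1B : logder (1 - a) (- geomlog).
Proof.
rewrite /logder /geomlog.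
have -> : theta (1 - a) = - (a *+ d).
  by rewrite -theta_monomial /theta derivB derivC sub0r mulrN.
rewrite mulNr; apply: eqmodXN; apply: eqmodX_sym.
have -> : geom * a *+ d * (1 - a) = (1 - a) * geom * (a *+ d).
  by rewrite mulrC -mulrA !mulrnAr.
by rewrite -[X in eqmodX _ X]mul1r; apply/eqmodXMr/geomE.
Qed.

(** Up to degree [n], [theta] kills [(1 - a) * geom], so by the Leibniz rule the logarithmic
    derivative of [geom] is opposite to that of [1 - a]. *)
Lemma logder_geom : logder geom geomlog.
Proof.
have := logder_1B; rewrite /logder => H.
have H1 : eqmodX (theta ((1 - a) * geom)) 0.
  by move=> k kn; rewrite coef_theta geomE // -coef_theta /theta derivC mulr0.
rewrite thetaM in H1.
have H2 : eqmodX ((1 - a) * theta geom) (geomlog * geom * (1 - a)).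
  move=> k kn; have := H1 k kn; rewrite coefD coef0 => /eqP.
  rewrite addrC addr_eq0 => /eqP ->; rewrite -coefN.
  rewrite -mulNr; rewrite (eqmodXMr geom (eqmodXN H)) //.
  by rewrite !mulNr opprK mulrAC.
(* Multiplying by [geom] cancels the factor [1 - a] on both sides. *)
have /(eqmodXMr geom) := H2; rewrite /logder => H3.
apply: (eqmodX_trans (q := (1 - a) * theta geom * geom)).
  rewrite mulrAC -[X in eqmodX X _]mul1r; apply: eqmodXMr; exact/eqmodX_sym/geomE.
apply: (eqmodX_trans H3).
rewrite -mulrA -[X in eqmodX _ X]mulr1; apply: eqmodXMl; exact: geomE.
Qed.

End Geometric.
End TruncatedSeries.

(** * Determinants *)

Section Jacobi.
Variable R : comNzRingType.

Lemma deriv_prod_seq (I : eqType) (r : seq I) (F : I -> {poly R}) : uniq r ->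
  (\prod_(i <- r) F i)^`() = \sum_(i <- r) (F i)^`() * \prod_(j <- r | j != i) F j.
Proof.
elim: r => [_|x r IH /= /andP[xr ur]]; first by rewrite !big_nil derivC.
rewrite !big_cons derivM IH // eqxx /= mulr_sumr; congr (_ * _ + _).
  rewrite -[RHS]big_filter (all_filterP _) //.
  by apply/allP => y yr; apply: contraNneq xr => <-.
apply: eq_big_seq => i ir; rewrite big_cons ifT; first by rewrite mulrCA.
by apply: contraNneq xr => ->.
Qed.

(** Differentiating every term of the determinant yields the sum over [i] of the determinants with
    row [i] differentiated; each is expanded along that row. *)
Lemma det_deriv m (B : 'M[{poly R}]_m) :
  (\det B)^`() = \tr (map_mx (@deriv R) B *m \adj B).
Proof.
pose C i := \matrix_(k, j) if k == i then (B k j)^`() else B k j.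
have -> : (\det B)^`() = \sum_i \det (C i).
  rewrite /determinant raddf_sum exchange_big; apply: eq_bigr => s _ /=.
  rewrite -mulr_sumr.
  have sgP (c : bool) : (-1) ^+ c = ((-1) ^+ c)%:P :> {poly R} by rewrite rmorph_sign.
  rewrite sgP mul_polyC derivZ -mul_polyC; congr (_ * _).
  rewrite deriv_prod_seq ?index_enum_uniq //; apply: eq_bigr => i _.
  rewrite [RHS](bigD1 i) //= !mxE eqxx; congr (_ * _).
  by apply: eq_bigr => j /negPf ji; rewrite !mxE ji.
rewrite /mxtrace; apply: eq_bigr => i _.
rewrite (expand_det_row _ i) mxE; apply: eq_bigr => j _; rewrite !mxE eqxx.
congr (_ * (_ * \det _)); apply/matrixP => k k'; rewrite !mxE.
by rewrite eq_sym (negPf (neq_lift _ _)).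
Qed.

Definition tracelog m (n : nat) (M : 'M[R]_m) : {poly R} :=
  \poly_(k < n.+1) (if (0 < k)%N then \tr (M ^+ k) else 0).

(** By Jacobi's formula [theta (\det B)] is the opposite of the trace of [zM] times the adjugate of
    [B]. Up to a multiple of [z^(n+1)], this adjugate is [\det B] times the geometric sum [G] of the
    powers of [zM]. *)
Lemma logder_det m n (M : 'M[R]_m) :
  logder n (\det (1%:M - 'X *: map_mx polyC M)) (- tracelog n M).
Proof.
set B := _ - _; set D := \det B.
pose G : 'M[{poly R}]_m := \sum_(i < n.+1) ('X *: map_mx polyC M) ^+ i.
have dB : map_mx (@deriv R) B = - map_mx polyC M.
  apply/matrixP => i j; rewrite !mxE derivB derivM derivX mul1r derivC mulr0 addr0.
  by rewrite derivMn -polyC1 derivC mul0rn sub0r.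
have powE i : ('X *: map_mx polyC M) ^+ i = 'X^i *: map_mx polyC (M ^+ i).
  elim: i => [|i IH].
    by rewrite !expr0 scale1r -[1 in RHS]/(1%:M) map_mx1.
  rewrite !exprS IH -[LHS]/(_ *m _) -[M * _]/(M *m _) map_mxM.
  by rewrite -scalemxAl -scalemxAr scalerA.
have adjG : D *: G = \adj B - \adj B *m (('X *: map_mx polyC M) ^+ n.+1).
  have := subrX1 ('X *: map_mx polyC M) n.+1; rewrite -/G => /(congr1 -%R).
  rewrite -mulNr !opprB => BG.
  have -> : \adj B - \adj B *m ('X *: map_mx polyC M) ^+ n.+1 =
            \adj B *m (1 - ('X *: map_mx polyC M) ^+ n.+1).
    by rewrite mulmxBr mulmx1.
  by rewrite BG -[_ * G]/(B *m G) mulmxA mul_adj_mx mul_scalar_mx.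
have adjE : \adj B = D *: G + \adj B *m (('X *: map_mx polyC M) ^+ n.+1).
  by rewrite adjG subrK.
have thD : theta D = - (\tr (('X *: map_mx polyC M) *m \adj B)).
  by rewrite /theta det_deriv dB mulNmx -scalemxAl mxtraceZ raddfN mulrN.
rewrite /logder mulNr thD; apply: eqmodXN.
rewrite [in X in eqmodX _ X _]adjE mulmxDr mxtraceD -[X in eqmodX _ _ X]addr0.
apply: eqmodXD; last first.
  move=> k kn; rewrite powE -2!scalemxAr mxtraceZ coefXnM ltnS kn coef0 //.
rewrite -scalemxAr mxtraceZ mulrC; apply: eqmodXMr.
rewrite /G mulmx_sumr raddf_sum => k kn; rewrite coef_poly ltnS kn coef_sum.
under eq_bigr => i _ do
  rewrite -[_ *m _]/(_ * _) -exprS powE /= mxtraceZ coefXnM.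
have trP (A : 'M[R]_m) : \tr (map_mx polyC A) = (\tr A)%:P.
  by rewrite /mxtrace raddf_sum; apply: eq_bigr => i _; rewrite mxE.
case: k kn => [|k] kn; first by rewrite big1.
rewrite (bigD1 (Ordinal (leqW kn))) //= ltnn subnn trP coefC eqxx.
rewrite big1 ?addr0 // => i ik; rewrite trP coefC subn_eq0 !ltnS.
case: ltngtP => // ki; by rewrite -val_eqE /= ki eqxx in ik.
Qed.
End Jacobi.

(** * Determinants under a rank-one perturbation *)

Section TwoValued.
Variable R : comNzRingType.

(** A Schur complement turns this into a bordered determinant in which [c] occurs in a single row,
    and the determinant is linear in that row. *)
Lemma det_rank1_affine m (A : 'M[R]_m) (y : 'cV[R]_m) :
  exists g, forall c, \det (A + c *: (y *m const_mx 1)) = \det A + c * g.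
Proof.
pose B c := block_mx (1%:M : 'M_1) (c *: const_mx 1) (- y) A.
have detB c : \det (B c) = \det (A + c *: (y *m const_mx 1)).
  have : B c *m block_mx 1%:M (- (c *: const_mx 1)) 0 1%:M =
     block_mx 1%:M 0 (- y) (A + c *: (y *m const_mx 1)).
    rewrite mulmx_block !mulmx0 !mulmx1 !mul1mx !addr0 addNr; congr block_mx.
    by rewrite mulmxN mulNmx opprK -scalemxAr addrC.
  move/(congr1 determinant); rewrite det_mulmx det_ublock det_lblock !det1.
  by rewrite !mulr1 mul1r.
exists (\det (block_mx (0 : 'M_1) (const_mx 1) (- y) A)) => c.
rewrite -detB.
have -> : \det A = \det (block_mx (1%:M : 'M_1) 0 (- y) A).
  by rewrite det_lblock det1 mul1r.
rewrite -[X in X + _]mul1r.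
apply: (determinant_multilinear (i0 := lshift m 0)).
- apply/rowP => j; rewrite !mxE; case: splitP => i0 // _; rewrite !mxE.
  by case: splitP => j' _; rewrite !mxE; ring.
- by apply/matrixP => i j; rewrite !mxE; case: splitP => i0 //; rewrite ord1.
- by apply/matrixP => i j; rewrite !mxE; case: splitP => i0 //; rewrite ord1.
Qed.

(* [det_rank1_affine] at [c = -a] and [c = -b], where the matrix is triangular. *)
Lemma det_two_valued m (d y : 'I_m -> R) (a b : R) :
  (a - b) * \det (\matrix_(i < m, j < m)
      if (i == j)%N then d i else y i * if (i < j)%N then a else b) =
  a * \prod_i (d i - y i * b) - b * \prod_i (d i - y i * a).
Proof.
set A := \matrix_(_, _) _.
have [g Hg] := det_rank1_affine A (\col_i y i).
have Ha : \det A + - a * g = \prod_i (d i - y i * a).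
  rewrite -Hg det_trig.
    by apply: eq_bigr => i _; rewrite !mxE eqxx big_ord1 !mxE; ring.
  apply/is_trig_mxP => i j ij; rewrite !mxE big_ord1 !mxE ij.
  by rewrite -val_eqE (ltn_eqF ij); ring.
have Hb : \det A + - b * g = \prod_i (d i - y i * b).
  rewrite -Hg -det_tr det_trig.
    by apply: eq_bigr => i _; rewrite !mxE eqxx big_ord1 !mxE; ring.
  apply/is_trig_mxP => i j ij; rewrite !mxE big_ord1 !mxE ltnNge (ltnW ij).
  by rewrite -val_eqE (gtn_eqF ij) /=; ring.
by rewrite -Ha -Hb; ring.
Qed.
End TwoValued.

(** * Transfer matrix *)

Section TransferMatrix.
Variables (R : comNzRingType) (N l : nat) (x : 'I_N -> R) (t : R).
Implicit Types (y z : letter N l) (w : seq (letter N l)) (u v : 'I_N).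

Definition okv y u := (barred y ==> (u <= y.1)%N) && (zero_unbarred y ==> (y.1 <= u)%N).
Definition ok y z := okv y z.1.

Definition lweight y : R := x y.1 * t ^+ colstat y.
Definition weight w : R := \prod_(y <- w) lweight y.

(** Here [u] encodes the absolute value of the letter that would follow the last letter of [w]. *)
Fixpoint chain w u := if w is y :: w' then okv y (head u (map fst w')) && chain w' u else true.

Lemma path_chain y w z : path ok y (rcons w z) = chain (y :: w) z.1.
Proof. by elim: w y => [|y' w IH] y //=; rewrite IH. Qed.

Lemma cycle_chain w v : w != [::] -> cycle ok w && (head v (map fst w) == v) =
   chain w v && (head v (map fst w) == v).
Proof.
case: w => // y w _; rewrite [cycle _ _]path_chain [head _ _]/=.
by case: eqP => [->|]; rewrite ?andbF.
Qed.

Lemma cycle_zip (T : Type) (e : rel T) (s : seq T) :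
  cycle e s = all (fun p => e p.1 p.2) (zip s (rot 1 s)).
Proof.
case: s => // a s; rewrite rot1_cons /=.
have : forall b, path e b (rcons s a) = all (fun p => e p.1 p.2) (zip (b :: s) (rcons s a)).
  by elim: s => [|c s IH] b //=; rewrite IH.
exact.
Qed.

Lemma circ_okE w :
  circ_ok w = cycle ok w && ((size w != 1%N) || all (fun y => ~~ barred y) w).
Proof. by rewrite cycle_zip. Qed.

(* Whether [y] may precede [z] depends on [z] only through its absolute value, so
   an N x N matrix suffices instead of one indexed by the letters. *)
Definition transfer : 'M[R]_N := \matrix_(v, u) \sum_(y | (y.1 == v) && okv y u) lweight y.

Lemma big_tuple_cons (T : finType) k (P : pred (k.+1.-tuple T)) (F : k.+1.-tuple T -> R) :
  \sum_(s | P s) F s = \sum_(a : T) \sum_(s : k.-tuple T | P [tuple of a :: s]) F [tuple of a :: s].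
Proof.
rewrite pair_big_dep /=.
rewrite (reindex (fun p : T * k.-tuple T => [tuple of p.1 :: p.2])) //.
exists (fun s : k.+1.-tuple T => (thead s, [tuple of behead s])) => [[a s]|s] _ /=.
  by rewrite theadE; congr pair; apply: val_inj.
by rewrite -tuple_eta.
Qed.

Lemma transfer_expE k v u :
  (transfer ^+ k) v u =
  \sum_(w : k.-tuple (letter N l) | chain w u && (head u (map fst w) == v)) weight w.
Proof.
elim: k v => [|k IH] v.
  rewrite expr0 mxE [RHS]big_mkcond (bigD1 [tuple]) //= big1 ?addr0; last first.
    by move=> w; case/eqP; apply: tuple0.
  by rewrite eq_sym /weight big_nil; case: eqP.
rewrite exprS mxE big_tuple_cons /=.
(* Sorting by the absolute value that follows [y] produces the intermediate index [v'] of the matrix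
   product. *)
have hdP y G := partition_big (F := G) (fun w : k.-tuple (letter N l) => head u (map fst w)) xpredT
  (P := fun w : k.-tuple (letter N l) => okv y (head u (map fst w)) && chain w u && (y.1 == v)).
under [RHS]eq_bigr => y _ do rewrite hdP //.
rewrite [RHS]exchange_big; apply: eq_bigr => v' _ /=.
rewrite IH mxE big_distrl big_mkcond; apply: eq_bigr => y _ /=.
case: ifP => [/andP[yv yv']|yvv'].
  rewrite big_distrr; apply: eq_big => w.
    by rewrite yv andbT; case: eqP => [->|]; rewrite ?andbF // yv'.
  by rewrite /weight big_cons.
rewrite big_pred0 // => w; case: (head u _ =P v') => [->|]; rewrite ?andbF // andbT.
by rewrite -andbA [chain _ _ && _]andbC andbA [_ && (y.1 == v)]andbC yvv'.
Qed.

Lemma trace_transfer k : (0 < k)%N ->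
  \tr (transfer ^+ k) = \sum_(w : k.-tuple (letter N l) | cycle ok w) weight w.
Proof.
move=> k0; rewrite /mxtrace.
under eq_bigr => v _ do rewrite transfer_expE.
(* The diagonal index [v] is the absolute value of the first letter, to which the walk returns. *)
case: k k0 => // k _; rewrite [RHS](partition_big (fun w : k.+1.-tuple _ => (thead w).1) predT) //=.
apply: eq_bigr => v _; apply: eq_bigl => w.
rewrite -cycle_chain; last by case: w => -[].
by case/tupleP: w => y w; rewrite theadE.
Qed.

Lemma big_option (I : finType) (P : pred (option I)) (F : option I -> R) :
  \sum_(o | P o) F o = (if P None then F None else 0) + \sum_(i | P (Some i)) F (Some i).
Proof.
rewrite big_mkcond [X in _ + X]big_mkcond (bigD1 None) //=; congr (_ + _).
rewrite (reindex_omap Some id) => [|[]] //=.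
by apply: eq_bigl => i; rewrite eqxx.
Qed.

(** For [v <= u] the unbarred letter may have every colour; otherwise colour 0, of weight [t^0 = 1],
    is lost. The barred letter adds [t^l] when [u <= v]. *)
Lemma transferE v u : (0 < l)%N ->
  transfer v u = x v * ((if (v <= u)%N then \sum_(m < l) t ^+ m else \sum_(m < l) t ^+ m - 1)
     + (if (u <= v)%N then t ^+ l else 0)).
Proof.
move=> l0; rewrite mxE.
have -> : \sum_(y | (y.1 == v) && okv y u) lweight y =
          \sum_(o | okv (v, o) u) lweight (v, o).
  rewrite (reindex_onto (fun o => (v, o)) snd) /=; last by move=> [v' o] /= /andP[/eqP->].
  by apply: eq_bigl => o; rewrite !eqxx andbT.
rewrite big_option addrC mulrDr /okv /lweight /=; congr (_ + _); last first.
  by rewrite andbT; case: ifP; rewrite // mulr0.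
rewrite -mulr_sumr; congr (_ * _).
case: leqP => _.
  by apply: eq_bigl => m; rewrite implybT.
rewrite [in RHS](bigD1 (Ordinal l0)) //= expr0 [1 + _]addrC addrK.
by apply: eq_bigl => m; rewrite implybF.
Qed.

(** This is [E(cz)]; writing ['X^1] matches the factors treated by [geom], with [d = 1]. *)
Definition elin (c : R) : {poly R} := \prod_v (1 - (c * x v) *: 'X^1).

Lemma det_transfer : (0 < l)%N ->
  (1 - t)%:P * \det (1%:M - 'X *: map_mx polyC transfer) = elin 1 - t%:P * elin (t ^+ l).
Proof.
move=> l0; set q := \sum_(m < l) t ^+ m.
(* Apart from the factor [- x_v z], the entries of [1 - zM] are [q] above the diagonal and
   [q - 1 + t^l = t q] below it, so [det_two_valued] applies with [a = 1] and [b = t]. *)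
have tq : t * q = q - 1 + t ^+ l.
  have := subrX1 t l; rewrite -/q => E.
  by rewrite -[t ^+ l](subrK 1) E; ring.
pose d v := 1 - (x v * (q + t ^+ l)) *: 'X : {poly R}.
pose y v := - ((x v * q) *: 'X) : {poly R}.
have -> : 1%:M - 'X *: map_mx polyC transfer = \matrix_(i < N, j < N)
      if (i == j)%N then d i else y i * if (i < j)%N then 1 else t%:P.
  apply/matrixP => i j; have := transferE i j l0; rewrite !mxE => ->.
  rewrite -/q -[i == j]val_eqE /=.
  case: ltngtP => ij; rewrite /d /y /=.
  - by rewrite mulr1 -mul_polyC addr0; ring.
  - rewrite -tq -mul_polyC !rmorphM; ring.
  - by rewrite -mul_polyC; ring.
rewrite rmorphB rmorph1 det_two_valued mul1r; congr (_ - _ * _).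
  have tqP : q%:P + (t ^+ l)%:P - t%:P * q%:P = 1 :> {poly R}.
    by rewrite -polyCM tq !(rmorphB, rmorphD); ring.
  apply: eq_bigr => v _; rewrite /d /y mul1r expr1.
  by rewrite -!mul_polyC !(rmorphM, rmorphD) /= -[in RHS](mulr1 (x v)%:P) -tqP; ring.
by apply: eq_bigr => v _; rewrite /d /y expr1 -!mul_polyC !(rmorphM, rmorphD) /=; ring.
Qed.
End TransferMatrix.

(** * Primitive words and necklaces *)

Section WordPowers.
Variable T : eqType.
Implicit Types (s w v : seq T) (i j c k : nat).

Definition wpow c w := flatten (nseq c w).

Lemma wpowS c w : wpow c.+1 w = w ++ wpow c w. Proof. by []. Qed.

Lemma wpowSr c w : wpow c.+1 w = wpow c w ++ w.
Proof. by rewrite /wpow -addn1 nseqD flatten_cat /= cats0. Qed.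

Lemma size_wpow c w : size (wpow c w) = (c * size w)%N.
Proof. by elim: c => // c IH; rewrite wpowS size_cat IH mulSn. Qed.

Lemma wpowM b c w : wpow b (wpow c w) = wpow (b * c) w.
Proof.
by elim: b => // b IH; rewrite wpowS IH mulSn /wpow nseqD flatten_cat.
Qed.

Lemma rot_wpow c w : rot (size w) (wpow c w) = wpow c w.
Proof. by case: c => [|c]; rewrite ?[RHS]wpowSr // wpowS rot_size_cat. Qed.

Lemma take_wpow c w : (0 < c)%N -> take (size w) (wpow c w) = w.
Proof. by case: c => // c _; rewrite wpowS take_size_cat. Qed.

Lemma take_rot_fixed c e w : rot e w = w -> (c * e <= size w)%N ->
  take (c * e) w = wpow c (take e w).
Proof.
move=> fw; elim: c => [|c IH]; first by rewrite mul0n take0.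
rewrite mulSn => le; rewrite takeD wpowS -IH; last by lia.
congr (_ ++ _); rewrite -[in RHS]fw /rot takel_cat // size_drop; lia.
Qed.

Lemma iter_rot i w : (i <= size w)%N -> iter i (rot 1) w = rot i w.
Proof.
elim: i => [|i IH] le; first by rewrite rot0.
by rewrite iterS IH 1?ltnW // (rotS le).
Qed.

Lemma iter_rot_mul c i w : iter i (rot 1) w = w -> iter (c * i) (rot 1) w = w.
Proof. by move=> fw; elim: c => // c IH; rewrite mulSn iterD IH. Qed.

(** By Bezout the gcd is a multiple of [i] minus a multiple of [j]. Iterates of [rot 1] are used
    because their exponents add up without any bound. *)
Lemma rot_fixed_gcd i j w : (i <= size w)%N -> (j <= size w)%N ->
  rot i w = w -> rot j w = w -> rot (gcdn i j) w = w.
Proof.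
case: (posnP i) => [->|i0]; first by rewrite gcd0n.
move=> iw jw fi fj; case: (egcdnP j i0) => a b E _.
have gw : (gcdn i j <= size w)%N by rewrite (leq_trans _ iw) // dvdn_leq // dvdn_gcdl.
rewrite -iter_rot //; rewrite -(iter_rot iw) in fi; rewrite -(iter_rot jw) in fj.
by rewrite -{2}(iter_rot_mul a fi) E addnC iterD iter_rot_mul.
Qed.

Lemma cycle_wpow (e : rel T) c w : (0 < c)%N -> cycle e (wpow c w) = cycle e w.
Proof.
case: c => // c _; case: w => [|y w]; first by elim: c.
rewrite wpowS /= rcons_cat; elim: c => [|c IH]; first by rewrite /= cats1.
rewrite wpowS rcons_cat cat_cons -cat_rcons cat_path last_rcons IH.
by rewrite andbb.
Qed.

End WordPowers.

Section Primitive.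
Variables N l : nat.
Implicit Types (w v : seq (letter N l)).

Lemma primitiveN w : (0 < size w)%N -> ~~ primitive w ->
  exists v d, [/\ (1 < d)%N, (0 < size v)%N & w = wpow d v].
Proof.
move=> w0; rewrite negbK => /existsP[d /andP[d1 /eqP E]].
exists (take (size w %/ d) w), (d : nat); split => //.
by move: w0; rewrite [in X in X -> _]E size_wpow muln_gt0 => /andP[].
Qed.

Lemma primitive_wpow v d : (0 < size v)%N -> (1 < d)%N -> ~~ primitive (wpow d v).
Proof.
move=> v0 d1; rewrite negbK; apply/existsP.
have dle : (d < (size (wpow d v)).+1)%N by rewrite ltnS size_wpow leq_pmulr.
exists (Ordinal dle); rewrite /= d1 /= size_wpow mulKn ?take_wpow //; lia.
Qed.

(** A rotation fixing [w] yields one whose length divides [size w], and [w] is then a proper power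
    of its prefix of that length. Conversely a power is fixed by rotating through one copy of its
    base. *)
Lemma primitive_rotP w : (0 < size w)%N ->
  primitive w <-> forall i, (0 < i < size w)%N -> rot i w <> w.
Proof.
move=> w0; split => [pw i /andP[i0 iw] fi|nf]; last first.
  apply: contraT => /(primitiveN w0)[v [d [d1 v0 E]]].
  case: (nf (size v)); last by rewrite E rot_wpow.
  by rewrite v0 E size_wpow ltn_Pmull.
have fg : rot (gcdn i (size w)) w = w.
  by apply: rot_fixed_gcd => //; rewrite ?(ltnW iw) // rot_size.
set g := gcdn _ _ in fg.
have g0 : (0 < g)%N by rewrite gcdn_gt0 i0.
have gi : (g <= i)%N by rewrite dvdn_leq // dvdn_gcdl.
have /dvdnP[d dE] : (g %| size w)%N by rewrite dvdn_gcdr.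
have d1 : (1 < d)%N by rewrite -(ltn_pmul2r g0) mul1n -dE (leq_ltn_trans gi).
have wE : w = wpow d (take g w) by rewrite -take_rot_fixed // -?dE // take_size.
have sg : (0 < size (take g w))%N by rewrite size_takel // ltnW // (leq_ltn_trans gi).
by have := primitive_wpow sg d1; rewrite -wE pw.
Qed.

Lemma primitive_rot i w : (0 < size w)%N -> primitive (rot i w) = primitive w.
Proof.
move=> w0; have w0' : (0 < size (rot i w))%N by rewrite size_rot.
apply/idP/idP => [/(primitive_rotP w0') nf|/(primitive_rotP w0) nf].
  apply/(primitive_rotP w0) => j jw E; apply: (nf j); first by rewrite size_rot.
  by rewrite rot_rot E.
apply/(primitive_rotP w0') => j; rewrite size_rot rot_rot => jw /rot_inj.
exact: nf.
Qed.

Lemma primitive_root_exists w : (0 < size w)%N ->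
  exists v c, [/\ primitive v, (0 < size v)%N, (0 < c)%N & w = wpow c v].
Proof.
have [k] := ubnP (size w); elim: k w => // k IH w wk w0.
have [pw|npw] := boolP (primitive w).
  by exists w, 1%N; split; rewrite // /wpow /= cats0.
have [v [d [d1 v0 E]]] := primitiveN w0 npw.
have [|u [c [pu u0 c0 Eu]]] := IH v _ v0.
  by rewrite -ltnS; apply: leq_trans wk; rewrite E size_wpow ltnS ltn_Pmull.
exists u, (d * c)%N; split; rewrite // ?muln_gt0 ?c0 ?andbT; first by lia.
by rewrite -wpowM -Eu.
Qed.

(** Rotating the common word [W] by the length of either root fixes it, hence so does rotating by
    their gcd [g]. Each root is a power of the prefix of length [g], and by primitivity equals
    it. *)
Lemma primitive_root_unique v v' c c' : primitive v -> primitive v' ->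
  (0 < size v)%N -> (0 < size v')%N -> (0 < c)%N -> (0 < c')%N ->
  wpow c v = wpow c' v' -> v = v'.
Proof.
move=> pv pv' v0 v0' c0 c0' E; set W := wpow c v in E.
set g := gcdn (size v) (size v').
have sv : (size v <= size W)%N by rewrite size_wpow leq_pmull.
have sv' : (size v' <= size W)%N by rewrite E size_wpow leq_pmull.
have fg : rot g W = W.
  by apply: rot_fixed_gcd => //; rewrite ?rot_wpow // E rot_wpow.
have key u : primitive u -> (0 < size u)%N -> (size u <= size W)%N ->
    u = take (size u) W -> (g %| size u)%N -> u = take g W.
  move=> pu u0 su uE /dvdnP[d dE].
  have gsu : (g <= size u)%N by rewrite dvdn_leq // dE dvdn_mull.
  have g0 : (0 < g)%N by rewrite gcdn_gt0 v0.
  have uP : u = wpow d (take g W) by rewrite uE dE take_rot_fixed // -dE.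
  have d0 : (0 < d)%N by move: u0; rewrite dE muln_gt0 => /andP[].
  case: (ltngtP d 1) d0 => // [d1|d1] _; last first.
    by rewrite uP d1 /wpow /= cats0.
  have sg : (0 < size (take g W))%N by rewrite size_takel // (leq_trans gsu).
  by have := primitive_wpow sg d1; rewrite -uP pu.
rewrite (key v) // ?dvdn_gcdl //; last by rewrite take_wpow.
by rewrite [RHS]key // ?dvdn_gcdr // E take_wpow.
Qed.

Lemma circ_ok_rot i w : circ_ok (rot i w) = circ_ok w.
Proof. by rewrite !circ_okE rot_cycle size_rot (eq_all_r (mem_rot i w)). Qed.
End Primitive.

(** * Necklaces as rotation classes of words *)

Section Words.
Variables N l n : nat.
Implicit Types (v : word N l n) (S : {set word N l n}) (w : seq (letter N l)).

Lemma wseq_inj : injective (@wseq N l n).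
Proof.
move=> [k s] [k' s']; rewrite /wseq /= => E.
have kk : k = k' by apply: val_inj; rewrite /= -(size_tuple s) -(size_tuple s') E.
by subst k'; congr existT; apply: val_inj.
Qed.

Lemma wseq_le v : (size (wseq v) <= n)%N.
Proof. by case: v => k s; rewrite /wseq /= size_tuple -ltnS. Qed.

Lemma wseq_surj w : (size w <= n)%N -> exists v, wseq v = w.
Proof.
move=> wn; have wn' : (size w < n.+1)%N by [].
by exists (existT (fun k : 'I_n.+1 => k.-tuple (letter N l)) (Ordinal wn') (in_tuple w)).
Qed.

Lemma rotclassP v w : (0 < size w)%N ->
  reflect (exists i, wseq v = rot i w) (v \in rotclass n w).
Proof.
move=> w0; rewrite inE; apply: (iffP mapP) => [[i _ ->]|[i E]]; first by exists i.
have [iw|wi] := ltnP i (size w); first by exists i; rewrite // mem_iota.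
by exists 0%N; rewrite ?mem_iota // E rot0 rot_oversize.
Qed.

Lemma rotclass_eq v w : (0 < size w)%N -> v \in rotclass n w ->
  rotclass n (wseq v) = rotclass n w.
Proof.
move=> w0 /rotclassP -/(_ w0)[i E].
have v0 : (0 < size (wseq v))%N by rewrite E size_rot.
apply/setP => u; apply/rotclassP/rotclassP => // -[j ->].
  by rewrite E rot_rot_add; eexists.
have -> : w = rotr i (wseq v) by rewrite E rotK.
by rewrite /rotr rot_rot_add; eexists.
Qed.

Lemma mem_rotclass v : (0 < size (wseq v))%N -> v \in rotclass n (wseq v).
Proof. by move=> v0; apply/rotclassP => //; exists 0%N; rewrite rot0. Qed.

(** The rotations of a primitive word by less than its length are pairwise distinct. *)
Lemma card_rotclass w : (0 < size w <= n)%N -> primitive w -> #|rotclass n w| = size w.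
Proof.
case/andP=> w0 wn pw.
have /fin_all_exists[f fE] : forall i : 'I_(size w), exists v, wseq v = rot i w.
  by move=> i; apply: wseq_surj; rewrite size_rot.
have -> : rotclass n w = [set f i | i : 'I_(size w)].
  apply/setP => v; rewrite inE; apply/mapP/imsetP.
    case=> i; rewrite mem_iota /= => iw E; exists (Ordinal iw) => //.
    by apply: wseq_inj; rewrite fE.
  by case=> i _ ->; exists (i : nat); rewrite ?mem_iota ?fE /=.
rewrite card_imset ?card_ord //.
have wlog_le (i j : 'I_(size w)) : (i < j)%N -> f i <> f j.
  move=> ij /(congr1 (@wseq N l n)); rewrite !fE -(subnK (ltnW ij)) addnC rotD; last first.
    by rewrite subnKC ltnW.
  move/rot_inj/esym; apply: (proj1 (primitive_rotP w0) pw).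
  by rewrite subn_gt0 ij (leq_ltn_trans (leq_subr _ _)).
move=> i j; case: (ltngtP i j) => [ij E|ij E|ij _]; last exact: val_inj.
  by case: (wlog_le _ _ ij).
by case: (wlog_le _ _ ij).
Qed.

Definition good v := [&& (0 < size (wseq v))%N, primitive (wseq v) & circ_ok (wseq v)].

Lemma good_rotclass v v' : good v -> (v' \in rotclass n (wseq v)) =
  good v' && (rotclass n (wseq v') == rotclass n (wseq v)).
Proof.
move=> gv; have /and3P[v0 pv cv] := gv.
apply/idP/andP => [vv|[/and3P[v0' _ _] /eqP <-]]; last exact: mem_rotclass.
rewrite (rotclass_eq v0 vv) eqxx; split => //.
by case/rotclassP: vv => // i E; rewrite /good E size_rot v0 primitive_rot // pv circ_ok_rot.
Qed.

Lemma necklaceP S : reflect (exists2 v, good v & S = rotclass n (wseq v)) (is_necklace S).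
Proof.
apply: (iffP existsP) => [[v /and4P[v0 pv cv /eqP E]]|[v /and3P[v0 pv cv] E]].
  by exists v => //; apply/and3P.
by exists v; apply/and4P; split=> //; apply/eqP.
Qed.

Lemma rep_rotclass v : good v -> exists i, rep (rotclass n (wseq v)) = rot i (wseq v).
Proof.
case/and3P=> v0 _ _; rewrite /rep; case: pickP => [u|/(_ v)].
  by move/rotclassP; apply.
by rewrite mem_rotclass.
Qed.

(** A necklace is the class of exactly [size (rep S)] good words, and [G] is constant on them. *)
Lemma sum_necklaces (V : zmodType) (G : seq (letter N l) -> V) :
  (forall i w, G (rot i w) = G w) ->
  \sum_(S : {set word N l n} | is_necklace S) G (rep S) *+ size (rep S) =
  \sum_(v | good v) G (wseq v).
Proof.
move=> Grot.
rewrite [RHS](partition_big (fun v => rotclass n (wseq v)) (@is_necklace N l n)); last first.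
  by move=> v gv; apply/necklaceP; exists v.
apply: eq_bigr => S /necklaceP[v gv ->].
have [i ->] := rep_rotclass gv; rewrite Grot size_rot.
under eq_bigl => v' do rewrite -good_rotclass //.
have /and3P[v0 pv cv] := gv.
under eq_bigr => v' /(rotclassP _ v0)[j ->] do rewrite Grot.
by rewrite sumr_const card_rotclass // v0 wseq_le.
Qed.

End Words.

(** * The ornament series *)

Section PowerSums.
Variables (R : comNzRingType) (N l n : nat) (x : 'I_N -> R) (t r : R).
Implicit Types (w : seq (letter N l)) (v : word N l n).

Let wgt := weight (l := l) x t.

Lemma weight_wpow c w : wgt (wpow c w) = wgt w ^+ c.
Proof.
by elim: c => [|c IH]; rewrite ?/wgt /weight ?big_nil // wpowS big_cat exprS -IH.
Qed.

Lemma weight_rot i w : wgt (rot i w) = wgt w.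
Proof. by apply: perm_big; rewrite perm_rot. Qed.

(** Every nonempty word is a power of a unique primitive word, and is a closed walk exactly when
    this root is. As [k <= n], the root is short enough to be a [word]. *)
Lemma closed_walks_primitive k : (0 < k <= n)%N ->
  \sum_(w : k.-tuple (letter N l) | cycle (@ok N l) w) wgt w =
  \sum_(v : word N l n | [&& (0 < size (wseq v))%N, primitive (wseq v),
      cycle (@ok N l) (wseq v) & (size (wseq v) %| k)%N])
    wgt (wseq v) ^+ (k %/ size (wseq v)).
Proof.
case/andP=> k0 kn.
pose root_of w v := [&& (0 < size (wseq v))%N, primitive (wseq v), (size (wseq v) %| k)%N
   & w == wpow (k %/ size (wseq v)) (wseq v)].
(* The default [word0] is never taken, as [rootP] shows. *)
pose root w := odflt (word0 N l n) [pick v | root_of w v].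
have rootP (w : k.-tuple _) : root_of w (root w).
  rewrite /root; case: pickP => // no.
  have w0 : (0 < size w)%N by rewrite size_tuple.
  have [u [c [pu u0 c0 E]]] := primitive_root_exists w0.
  have kE : k = (c * size u)%N by rewrite -size_wpow -E size_tuple.
  have [|v vE] := @wseq_surj N l n u.
    by rewrite (leq_trans _ kn) // kE leq_pmull.
  have du : (size u %| k)%N by rewrite kE dvdn_mull.
  have ck : (k %/ size u)%N = c by rewrite kE mulnK.
  by have := no v; rewrite /root_of vE pu u0 du ck E eqxx.
have rootE (w : k.-tuple _) v : root_of w v -> root w = v.
  move=> /and4P[v0 pv dv /eqP Ev]; have /and4P[u0 pu du /eqP Eu] := rootP w.
  apply: wseq_inj; apply: (primitive_root_unique (c := (k %/ size (wseq (root w)))%N)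
    (c' := (k %/ size (wseq v))%N) pu pv u0 v0).
  - by rewrite divn_gt0 // dvdn_leq.
  - by rewrite divn_gt0 // dvdn_leq.
  - by rewrite -Eu.
rewrite (partition_big (fun w : k.-tuple _ => root w)
    (fun v => [&& (0 < size (wseq v))%N, primitive (wseq v),
      cycle (@ok N l) (wseq v) & (size (wseq v) %| k)%N])) /=; last first.
  move=> w cw; have /and4P[u0 -> dv /eqP E] := rootP w; rewrite u0 dv andbT /=.
  by move: cw; rewrite {1}E cycle_wpow // divn_gt0 // dvdn_leq.
apply: eq_bigr => v /and4P[v0 pv cv dv].
have szv : size (wpow (k %/ size (wseq v)) (wseq v)) == k by rewrite size_wpow divnK.
rewrite (big_pred1 (Tuple szv)) /= ?weight_wpow // => w /=.
apply/andP/eqP => [[_ /eqP rw]|->].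
  by apply: val_inj; have /and4P[_ _ _ /eqP] := rootP w; rewrite rw.
rewrite cycle_wpow ?cv; last by rewrite divn_gt0 // dvdn_leq.
by split=> //; apply/eqP/rootE; rewrite /root_of v0 pv dv eqxx.
Qed.

Definition single w := (size w == 1%N) && all (@zero_unbarred N l) w.

(* [r] marks the necklaces counted by [jstat]. *)
Definition rweight w := wgt w * (if single w then r else 1).

Lemma single_rot i w : single (rot i w) = single w.
Proof. by rewrite /single size_rot (eq_all_r (mem_rot i w)). Qed.

Lemma rweight_rot i w : rweight (rot i w) = rweight w.
Proof. by rewrite /rweight weight_rot single_rot. Qed.

Definition psum (c : R) k := \sum_u (c * x u) ^+ k.

Lemma primitive1 (y : letter N l) : primitive [:: y].
Proof. by apply/primitive_rotP => // i /andP[i0 /=]; case: i i0. Qed.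

Lemma sum_size1 (F : seq (letter N l) -> R) (P : pred (seq (letter N l))) : (0 < n)%N ->
  \sum_(v : word N l n | (size (wseq v) == 1%N) && P (wseq v)) F (wseq v) =
  \sum_(y | P [:: y]) F [:: y].
Proof.
move=> n0.
pose h (y : letter N l) : word N l n := existT (fun k : 'I_n.+1 => k.-tuple (letter N l))
  (Ordinal (n0 : (1 < n.+1)%N)) [tuple y].
have hE y : wseq (h y) = [:: y] by [].
rewrite (reindex_omap h (fun v => ohead (wseq v))); last first.
  move=> v /andP[]; case E : (wseq v) => [|y []] //= _ _; congr Some.
  by apply: wseq_inj; rewrite hE E.
by apply: eq_big => y //; rewrite hE /= eqxx andbT.
Qed.

(** Good words and primitive closed walks differ only in length one: there condition (3) discards
    the barred letters, of weight [x_u t^l], and the letters [u^0] weigh [r x_u] instead of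
    [x_u]. *)
Lemma sum_good_rweight k : (0 < l)%N -> (0 < k <= n)%N ->
  \sum_(v : word N l n | good v && (size (wseq v) %| k)%N)
     rweight (wseq v) ^+ (k %/ size (wseq v)) =
  \tr (transfer l x t ^+ k) + (psum r k - psum 1 k - psum (t ^+ l) k).
Proof.
move=> l0 kP; have /andP[k0 kn] := kP.
have n0 : (0 < n)%N by rewrite (leq_trans k0).
rewrite trace_transfer // closed_walks_primitive //.
rewrite (bigID (fun v => size (wseq v) == 1%N)) [in RHS](bigID (fun v => size (wseq v) == 1%N)) /=.
rewrite -addrA [X in _ = _ + X]addrC addrA; congr (_ + _); last first.
  apply: eq_big => v.
    by rewrite /good circ_okE -!andbA; case: eqP; rewrite ?andbF //= andbT.
  by case/andP=> _ /negPf s1; rewrite /rweight /single s1 mulr1.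
have -> : \sum_(v : word N l n | good v && (size (wseq v) %| k)%N && (size (wseq v) == 1%N))
   rweight (wseq v) ^+ (k %/ size (wseq v)) =
   \sum_(v : word N l n | (size (wseq v) == 1%N) && all (fun y => ~~ barred y) (wseq v))
    rweight (wseq v) ^+ (k %/ size (wseq v)).
  apply: eq_bigl => v; rewrite /good circ_okE.
  case: (wseq v) => [|y [|? ?]]; rewrite ?andbF //= primitive1 dvd1n /ok /okv leqnn.
  by rewrite !implybT !andbT.
rewrite (sum_size1 (fun w => rweight w ^+ (k %/ size w)) (all (fun y => ~~ barred y))) //.
have -> : \sum_(v : word N l n | [&& (0 < size (wseq v))%N, primitive (wseq v),
      cycle (@ok N l) (wseq v) & (size (wseq v) %| k)%N] && (size (wseq v) == 1%N))
     wgt (wseq v) ^+ (k %/ size (wseq v)) =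
   \sum_(v : word N l n | (size (wseq v) == 1%N) && predT (wseq v))
    wgt (wseq v) ^+ (k %/ size (wseq v)).
  apply: eq_bigl => v.
  case: (wseq v) => [|y [|? ?]]; rewrite ?andbF //= primitive1 dvd1n /ok /okv leqnn.
  by rewrite !implybT.
rewrite (sum_size1 (fun w => wgt w ^+ (k %/ size w)) predT) //.
have sumlet (P : pred (letter N l)) (F : letter N l -> R) :
   \sum_(y | P y) F y = \sum_u \sum_(o | P (u, o)) F (u, o).
  by rewrite pair_big_dep /=; apply: eq_big => [[]|[]].
rewrite !sumlet /psum -!sumrB -big_split; apply: eq_bigr => u _ /=.
rewrite !big_option /= /barred /= add0r !(bigD1 (Ordinal l0) (P := fun=> true)) //=.
rewrite /rweight /wgt /weight !big_seq1 /lweight /single /= !divn1 expr0 !mulr1 mul1r.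
have -> : \sum_(i < l | i != Ordinal l0)
     (\prod_(y <- [:: (u, Some i)]) (x y.1 * t ^+ colstat y) *
      (if zero_unbarred (u, Some i) && true then r else 1)) ^+ k =
   \sum_(i < l | i != Ordinal l0)
      (\prod_(y <- [:: (u, Some i)]) (x y.1 * t ^+ colstat y)) ^+ k.
  apply: eq_bigr => m ml; rewrite /zero_unbarred /= ifF ?mulr1 //.
  by rewrite andbT; apply: contraNF ml => m0; rewrite -val_eqE.
rewrite [colstat _]/= [r * _]mulrC [_ * x u]mulrC; ring.
Qed.

End PowerSums.

Section OrnamentSeries.
Variables (R : comNzRingType) (N l n : nat) (x : 'I_N -> R) (t r : R).
Implicit Types (S : {set word N l n}).

Definition ornament_series : {poly R} :=
  \prod_(S : {set word N l n} | is_necklace S) geom n (size (rep S)) (rweight x t r (rep S)).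

Lemma coef_ornament_series :
  ornament_series`_n =
  \sum_(Q : ornament N l n | is_ornament Q && (nletters Q == n))
     \prod_(S : {set word N l n}) rweight x t r (rep S) ^+ Q S.
Proof.
rewrite /ornament_series big_mkcond /=.
(* For a set that is no necklace only multiplicity 0 survives, so distributivity gives a sum over
   all multiplicity functions. *)
have -> : \prod_(S : {set word N l n}) (if is_necklace S then
      geom n (size (rep S)) (rweight x t r (rep S)) else 1) =
   \prod_(S : {set word N l n}) \sum_(i : 'I_n.+1)
     (if (i != 0 :> nat) ==> is_necklace S then
        (rweight x t r (rep S) *: 'X^(size (rep S))) ^+ i else 0).
  apply: eq_bigr => S _; case: ifP => nS.
    by apply: eq_bigr => i _; rewrite implybT.
  rewrite big_ord_recl /= expr0 big1 ?addr0 // => i _.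
rewrite bigA_distr_bigA coef_sum [RHS]big_mkcond /=; apply: eq_bigr => Q _.
have [oQ|noQ] := boolP (is_ornament Q); last first.
  move: noQ; rewrite negb_forall => /existsP[S /negPf nS].
  by rewrite (bigD1 S) //= nS mul0r coef0.
have -> : \prod_S (if (Q S != 0 :> nat) ==> is_necklace S then
        (rweight x t r (rep S) *: 'X^(size (rep S))) ^+ Q S else 0) =
   (\prod_S rweight x t r (rep S) ^+ Q S) *: 'X^(nletters Q).
  rewrite /nletters.
  apply: (big_rec3 (fun (p : {poly R}) c d => p = c *: 'X^d)); first by rewrite expr0 scale1r.
  move=> S p c d _ ->; move/forallP/(_ S): oQ => ->.
  by rewrite exprZn -exprM mulnC -scalerAl -scalerAr scalerA exprD.
rewrite coefZ coefXn eq_sym; case: eqP => _; rewrite ?mulr1 ?mulr0 //.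
Qed.

Definition necklace_log : {poly R} :=
  \sum_(S : {set word N l n} | is_necklace S) geomlog n (size (rep S)) (rweight x t r (rep S)).

Lemma rep_gt0 S : is_necklace S -> (0 < size (rep S))%N.
Proof.
case/necklaceP => v gv ->; have [i ->] := rep_rotclass gv.
by rewrite size_rot; case/and3P: gv.
Qed.

Lemma logder_ornament : logder n ornament_series necklace_log.
Proof. by apply: logder_prod => S /rep_gt0; apply: logder_geom. Qed.

Lemma coef0_ornament : ornament_series`_0 = 1.
Proof.
rewrite -horner_coef0 horner_prod big1 // => S /rep_gt0 s0.
rewrite /geom big_ord_recl expr0 hornerD hornerC horner_sum big1 ?addr0 // => i _.
by rewrite hornerE hornerZ hornerXn expr0n (gtn_eqF s0) mulr0 exprS mul0r.
Qed.

(** The factor [size (rep S)] in [geomlog] turns the sum over necklaces into one over good words,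
    which [sum_good_rweight] evaluates. *)
Lemma coef_necklace_log k : (0 < l)%N -> (k <= n)%N ->
  necklace_log`_k = if (0 < k)%N then
    \tr (transfer l x t ^+ k) + (psum x r k - psum x 1 k - psum x (t ^+ l) k) else 0.
Proof.
move=> l0 kn; rewrite coef_sum.
under eq_bigr => S /rep_gt0 s0 do rewrite coef_geomlog //.
case: posnP => [->|k0] /=; first by rewrite big1.
rewrite -(@sum_good_rweight R N l n) ?k0 // big_mkcondr /=.
rewrite -(sum_necklaces n (G := fun w =>
    if (size w %| k)%N then rweight x t r w ^+ (k %/ size w) else 0)).
  by apply: eq_bigr => S _; case: ifP; rewrite ?mul0rn.
by move=> i w; rewrite size_rot rweight_rot.
Qed.
End OrnamentSeries.

Lemma logder_le (R : comNzRingType) (m n : nat) (p L : {poly R}) :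
  (m <= n)%N -> logder n p L -> logder m p L.
Proof. by move=> mn pL k km; apply: pL; apply: leq_trans mn. Qed.

Lemma coefM_monic0 (R : comNzRingType) (p q : {poly R}) k : q`_0 = 1 ->
  (p * q)`_k = \sum_(i < k) p`_i * q`_(k - i) + p`_k.
Proof. by move=> q0; rewrite coefM big_ord_recr /= subnn q0 mulr1. Qed.

Lemma eqmodX_cancelr (R : comNzRingType) n (p p' q : {poly R}) :
  q`_0 = 1 -> eqmodX n (p * q) (p' * q) -> eqmodX n p p'.
Proof.
move=> q0 E; elim/ltn_ind => k IH kn; have := E k kn.
rewrite !coefM_monic0 //; under eq_bigr => i _ do rewrite IH ?(leq_trans (ltnW (ltn_ord i))) //.
by move/addrI.
Qed.

Section Dilation.
Variable R : comNzRingType.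

(** As series, [p(z) = q(cz)]. *)
Definition dilated (c : R) (p q : {poly R}) := forall k, p`_k = c ^+ k * q`_k.

Lemma dilated_prod (I : finType) (c : R) (p q : I -> {poly R}) :
  (forall i, dilated c (p i) (q i)) -> dilated c (\prod_i p i) (\prod_i q i).
Proof.
move=> pq; apply: (big_ind2 (dilated c)) => // [k|p1 q1 p2 q2 H1 H2 k].
  by rewrite coef1; case: eqP => [->|]; rewrite ?mulr0 ?expr0 ?mulr1.
rewrite !coefM mulr_sumr; apply: eq_bigr => i _; rewrite H1 H2.
have -> : c ^+ k = c ^+ i * c ^+ (k - i) by rewrite -exprD subnKC // leq_ord.
ring.
Qed.
End Dilation.

(** * The ornament series and the determinant *)

Section KeyIdentity.
Variables (R : comNzRingType) (N l n : nat) (x : 'I_N -> R) (t r : R).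
Hypothesis l_gt0 : (0 < l)%N.
Hypothesis Rtf : forall (a : R) k, a *+ k.+1 = 0 -> a = 0.

Definition tdet : {poly R} := \det (1%:M - 'X *: map_mx polyC (transfer l x t)).
Definition hser (c : R) : {poly R} := \prod_v geom n 1 (c * x v).

Lemma tdet_coef0 : tdet`_0 = 1.
Proof.
rewrite -horner_coef0 -[_.[0]]/(horner_eval 0 tdet) -det_map_mx.
rewrite (_ : map_mx _ _ = 1%:M) ?det1 //; apply/matrixP => i j.
by rewrite !mxE rmorphB rmorphM rmorph_nat /= /horner_eval hornerX mul0r subr0.
Qed.

Lemma elin_coef0 c : (elin x c)`_0 = 1.
Proof.
rewrite -horner_coef0 horner_prod big1 // => v _.
by rewrite expr1 !hornerE ?mulr0 ?subr0.
Qed.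

Lemma elin_dilated c : dilated c (elin x c) (elin x 1).
Proof.
apply: dilated_prod => v k; rewrite !coefB !coef1 !coefZ !coefX mul1r.
by case: k => [|[|k]]; rewrite /= ?expr0 ?expr1; ring.
Qed.

Lemma hser_dilated c : dilated c (hser c) (hser 1).
Proof.
apply: dilated_prod => v k; rewrite /geom !coef_sum mulr_sumr.
apply: eq_bigr => i _; rewrite !exprZn !coefZ -exprM mul1n coefXn mul1r exprMn.
by case: eqP => [->|]; rewrite ?mulr0 // !mulr1.
Qed.

Lemma elin_hser c : eqmodX n (elin x c * hser c) 1.
Proof.
rewrite /elin /hser -big_split /=.
apply: (big_ind (fun p => eqmodX n p 1)) => // [p q pE qE|v _].
  by rewrite -[X in eqmodX _ _ X]mulr1; apply: eqmodXM.
exact: geomE.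
Qed.

Definition plog (c : R) : {poly R} := \sum_v geomlog n 1 (c * x v).

Lemma coef_plog c k : (k <= n)%N -> (plog c)`_k = if (0 < k)%N then psum x c k else 0.
Proof.
move=> kn; rewrite coef_sum.
under eq_bigr => v _ do rewrite coef_geomlog // dvd1n divn1 andbT mulr1n.
by case: posnP => // _; rewrite big1.
Qed.

Lemma logder_elin c : logder n (elin x c) (- plog c).
Proof.
rewrite /plog -sumrN; apply: logder_prod => v _; exact: logder_1B.
Qed.

(* Both sides have constant term 1 and the same logarithmic derivative. *)
Lemma ornament_det :
  eqmodX n (ornament_series l n x t r * tdet * elin x r) (elin x 1 * elin x (t ^+ l)).
Proof.
apply: (logder_uniq (L := - plog 1 + - plog (t ^+ l))) => //.
- by rewrite coefD !coefN !coef_plog // subr0 oppr0.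
- by rewrite !coef0M coef0_ornament tdet_coef0 !elin_coef0 !mulr1.
(* The traces and the power sums in [r] cancel. *)
- apply: (@logder_congr _ _ _ (necklace_log l n x t r + - tracelog n (transfer l x t) + - plog r)).
    move=> k kn; rewrite !coefD !coefN !coef_plog // coef_necklace_log // coef_poly ltnS kn.
    by case: ifP => _; ring.
  apply: logderM (logder_elin _); apply: logderM; last exact: logder_det.
  exact: logder_ornament.
by apply: logderM; apply: logder_elin.
Qed.

(** The two series range over different types, of words of length at most [n] and at most [k].
    Comparing logarithmic derivatives up to degree [k] replaces a bijection between them. *)
Lemma ornament_series_le k : (k <= n)%N ->
  (ornament_series l n x t r)`_k = (ornament_series l k x t r)`_k.
Proof.
move=> kn; apply: (@logder_uniq _ k _ _ (necklace_log l k x t r)) => //.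
- by rewrite coef_necklace_log.
- by rewrite !coef0_ornament.
- apply: logder_congr (logder_le kn (logder_ornament _ _ _ _)) => i ik.
  by rewrite !coef_necklace_log // (leq_trans ik).
exact: logder_ornament.
Qed.

Lemma hser_ornament_det :
  eqmodX n (hser 1 * ornament_series l n x t r * tdet) (elin x (t ^+ l) * hser r).
Proof.
(* The inserted factor [E(rz) H(rz)] is 1 up to degree [n] and makes [ornament_det] applicable;
   afterwards [E(z) H(z)] is removed in the same way. *)
apply: (@eqmodX_trans _ _ (elin x r * hser r * (hser 1 * ornament_series l n x t r * tdet))).
  by rewrite -[X in eqmodX _ X _]mul1r; apply/eqmodXMr/eqmodX_sym/elin_hser.
have -> : elin x r * hser r * (hser 1 * ornament_series l n x t r * tdet) =
   (ornament_series l n x t r * tdet * elin x r) * (hser r * hser 1) by ring.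
apply: (eqmodX_trans (eqmodXMr _ ornament_det)).
have -> : elin x 1 * elin x (t ^+ l) * (hser r * hser 1) =
  (elin x 1 * hser 1) * (elin x (t ^+ l) * hser r) by ring.
by rewrite -[X in eqmodX _ _ X]mul1r; apply/eqmodXMr/elin_hser.
Qed.
End KeyIdentity.

(** * Change of the coefficient ring *)

Section Morphism.
Variables (R R' : comNzRingType) (f : {rmorphism R -> R'}) (N l n : nat) (x : 'I_N -> R) (t : R).

Lemma map_elin c : map_poly f (elin x c) = elin (f \o x) (f c).
Proof.
rewrite rmorph_prod; apply: eq_bigr => v _.
by rewrite rmorphB rmorph1 /= linearZ /= map_polyXn rmorphM.
Qed.

Lemma map_hser c : map_poly f (hser n x c) = hser n (f \o x) (f c).
Proof.
rewrite rmorph_prod; apply: eq_bigr => v _.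
rewrite rmorph_sum; apply: eq_bigr => i _.
by rewrite rmorphXn /= linearZ /= map_polyXn rmorphM.
Qed.

Lemma map_tdet : map_poly f (tdet l x t) = tdet l (f \o x) (f t).
Proof.
rewrite /tdet -det_map_mx; congr (\det _); apply/matrixP => i j.
rewrite !mxE rmorphB rmorphM rmorphMn rmorph1 /= map_polyX map_polyC /=.
congr (_ - _ * _%:P); rewrite rmorph_sum; apply: eq_bigr => y _.
by rewrite /lweight rmorphM rmorphXn.
Qed.
End Morphism.

(** * Reversal of polynomials *)

Section Mirror.
Variable R : comNzRingType.
Implicit Types p q : {poly R}.

(* [mirror d p q] says that [q = t^d p(1/t)] and that both have degree at most [d]. *)
Definition mirrors d p q := forall i, p`_i = if (i <= d)%N then q`_(d - i) else 0.
Definition mirror d p q := mirrors d p q /\ mirrors d q p.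

Lemma mirrors_sum d (I : finType) (p q : I -> {poly R}) :
  (forall i, mirrors d (p i) (q i)) -> mirrors d (\sum_i p i) (\sum_i q i).
Proof.
move=> H k; rewrite !coef_sum; case: ifP => kd.
  by apply: eq_bigr => i _; rewrite H kd.
by apply: big1 => i _; rewrite H kd.
Qed.

Lemma mirrorsB d p q p' q' : mirrors d p q -> mirrors d p' q' -> mirrors d (p - p') (q - q').
Proof.
by move=> H H' k; rewrite !coefB H H'; case: ifP; rewrite ?subr0.
Qed.

(** The factor [1 + ... + 'X^e] is palindromic: reversing the summation in the second product pairs
    ['X^a] with ['X^(e - a)]. *)
Lemma mirrorsM d e p q : mirror d p q ->
  mirrors (e + d) (p * \sum_(i < e.+1) 'X^i) (q * \sum_(i < e.+1) 'X^i).
Proof.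
move=> [pq qp]; rewrite [X in mirrors _ _ (_ * X)](reindex_inj rev_ord_inj) /=.
rewrite !mulr_sumr; apply: mirrors_sum => a k; have ae := leq_ord a.
rewrite !coefMXn subSS.
have q0 i : (d < i)%N -> q`_i = 0 by move=> di; rewrite qp leqNgt di.
have p0 i : (d < i)%N -> p`_i = 0 by move=> di; rewrite pq leqNgt di.
case: ltnP => ka; case: ltnP => kb; case: leqP => kd //.
- by rewrite q0 //; lia.
- by rewrite p0 //; lia.
- by rewrite p0 //; lia.
- by rewrite pq ifT; [congr (q`_ _)|]; lia.
by rewrite p0 //; lia.
Qed.

Lemma mirrorsZ d (c : R) p q : mirrors d p q -> mirrors d (c *: p) (c *: q).
Proof. by move=> H k; rewrite !coefZ H; case: ifP; rewrite ?mulr0. Qed.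

Lemma mirrors_Xn d : mirror d 'X^d 1.
Proof.
split=> k; rewrite coefXn coef1; case: leqP => kd.
- by have -> : (k == d) = (d - k == 0)%N by lia.
- by rewrite (gtn_eqF kd).
- by have -> : (k == 0)%N = (d - k == d)%N by lia.
by rewrite gtn_eqF // (leq_trans _ kd).
Qed.

End Mirror.

(** * Symmetry *)

Section Symmetry.
Variables (A : idomainType) (N l n : nat) (x : 'I_N -> A).
Hypothesis l_gt0 : (0 < l)%N.
Let xP : 'I_N -> {poly A} := polyC \o x.
Let D : {poly {poly A}} := tdet l xP 'X.
Let eps k : A := (elin x 1)`_k.

Lemma coef_elin1 k : (elin xP 1)`_k = (eps k)%:P.
Proof. by rewrite -[1]/(1%:P) -(map_elin (polyC : {rmorphism A -> {poly A}})) coef_map. Qed.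

Lemma coef_elinX k : (elin xP ('X^l))`_k = eps k *: 'X^(l * k).
Proof. by rewrite elin_dilated coef_elin1 -exprM mulrC mul_polyC. Qed.

(** Coefficientwise [det_transfer] reads [(1 - t) D_k = eps_k (1 - t^(lk+1))], and [1 - t] cancels
    in an integral domain. *)
Lemma coef_tdet k : D`_k = eps k *: \sum_(i < (l * k).+1) 'X^i.
Proof.
have X1 : 1 - 'X != 0 :> {poly A}.
  by rewrite -opprB oppr_eq0 -polyC1 polyXsubC_eq0.
apply: (mulfI X1); have := congr1 (fun p : {poly {poly A}} => p`_k) (det_transfer xP 'X l_gt0).
rewrite -/(tdet l xP 'X) -/D coefCM coefB coefCM coef_elin1 coef_elinX => ->.
have S : (1 - 'X) * \sum_(i < (l * k).+1) 'X^i = 1 - 'X ^+ (l * k).+1 :> {poly A}.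
  by rewrite -opprB mulNr -subrX1 opprB.
by rewrite -[RHS]scalerAr S scalerBr exprS scalerAr alg_polyC.
Qed.

(* [t G + 1 - t] is the quotient of [elin xP 1] by the same [D]; compare the two
   recursions for the coefficients. *)
Lemma mirror_quotient (G : {poly {poly A}}) : eqmodX n (G * D) (elin xP ('X^l)) ->
  forall k, (0 < k <= n)%N -> mirrors (l * k) G`_k ('X * G`_k).
Proof.
move=> GD; pose G' := 'X%:P * G + (1 - 'X)%:P.
have D0 : D`_0 = 1 by apply: tdet_coef0.
have G'D : eqmodX n (G' * D) (elin xP 1).
  have -> : elin xP 1 = 'X%:P * elin xP ('X^l) + (1 - 'X)%:P * D.
    by rewrite /D det_transfer // addrC subrK.
  rewrite mulrDl -mulrA; apply: eqmodXD => //; exact: eqmodXMl.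
have G'E k : G'`_k = 'X * G`_k + (if k == 0%N then 1 - 'X else 0).
  by rewrite coefD coefCM coefC.
(* [G'] differs from ['X * G] only at [k = 0], where [G_0 = G'_0 = 1] lets the induction start. *)
suff H k : (k <= n)%N -> mirror (l * k) G`_k G'`_k.
  by move=> k /andP[k0 /H[]]; rewrite G'E (gtn_eqF k0) addr0.
elim/ltn_ind: k => k IH kn.
have -> : G`_k = eps k *: 'X^(l * k) - \sum_(i < k) G`_i * D`_(k - i).
  by rewrite -coef_elinX -GD // coefM_monic0 // addrC addKr.
have -> : G'`_k = eps k *: 1 - \sum_(i < k) G'`_i * D`_(k - i).
  by rewrite [_ *: 1]alg_polyC -coef_elin1 -G'D // coefM_monic0 // addrC addKr.
have [m1 m2] := mirrors_Xn A (l * k).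
have m3 (i : 'I_k) : mirror (l * k) (G`_i * D`_(k - i)) (G'`_i * D`_(k - i)).
  have ik := ltn_ord i; have [M1 M2] := IH i ik (leq_trans (ltnW ik) kn).
  (* The degree [l k] splits into [l (k - i)] from [D] and [l i] from the induction hypothesis. *)
  have -> : (l * k = l * (k - i) + l * i)%N by rewrite -mulnDr subnK // ltnW.
  by rewrite coef_tdet -!scalerAr; split; apply/mirrorsZ/mirrorsM.
by split; apply: mirrorsB; try exact: mirrorsZ; apply: mirrors_sum => i; have [] := m3 i.
Qed.
End Symmetry.

(** * Statistics of ornaments as exponents *)

Section OrnamentMonomial.
Variables (R : comNzRingType) (N l m : nat) (x : 'I_N -> R).
Let x2 (v : 'I_N) : {poly {poly R}} := (x v)%:P%:P.

(* The outer variable of {poly {poly R}} plays the role of r, the inner one that of t. *)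
Definition statmon (p : {poly {poly R}}) a b c := p = 'X^a * ('X^b * c%:P)%:P.

Lemma statmonM p p' a b c a' b' c' : statmon p a b c -> statmon p' a' b' c' ->
  statmon (p * p') (a + a') (b + b') (c * c').
Proof. by rewrite /statmon => -> ->; rewrite !exprD !polyCM; ring. Qed.

Lemma statmon1 : statmon 1 0 0 1.
Proof. by rewrite /statmon !expr0 !mul1r. Qed.

Lemma statmonX p a b c i : statmon p a b c -> statmon (p ^+ i) (i * a) (i * b) (c ^+ i).
Proof.
move=> pE; elim: i => [|i IH]; first by rewrite !expr0; apply: statmon1.
by rewrite !exprS !mulSn; apply: statmonM.
Qed.

Lemma statmon_weight (w : seq (letter N l)) :
  statmon (weight x2 'X%:P w) 0 (\sum_(y <- w) colstat y) (\prod_(y <- w) x y.1).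
Proof.
rewrite /weight; elim: w => [|y w IH]; rewrite ?big_nil ?big_cons; first exact: statmon1.
rewrite -[0%N]/(0 + 0)%N; apply: statmonM IH.
by rewrite /statmon /lweight expr0 mul1r mulrC !polyCM polyC_exp.
Qed.

Lemma statmon_rweight (w : seq (letter N l)) :
  statmon (rweight x2 'X%:P 'X w) (single w) (\sum_(y <- w) colstat y) (\prod_(y <- w) x y.1).
Proof.
rewrite /rweight mulrC -[single w : nat]addn0 -[X in statmon _ _ X _]add0n.
rewrite -[X in statmon _ _ _ X]mul1r; apply: statmonM (statmon_weight w).
by rewrite /statmon expr0 !mul1r; case: single; rewrite ?expr0 ?expr1 mulr1.
Qed.

Lemma statmon_ornament (Q : ornament N l m) :
  statmon (\prod_S rweight x2 'X%:P 'X (rep S) ^+ Q S) (jstat Q) (kstat Q)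
    (\prod_(S : {set word N l m}) (\prod_(y <- rep S) x y.1) ^+ Q S).
Proof.
rewrite /jstat /kstat.
elim: (index_enum _) => [|S s IH]; first by rewrite !big_nil; apply: statmon1.
rewrite !big_cons -[single_u0 S]/(single (rep S)).
have := statmonM (statmonX (Q S) (statmon_rweight (rep S))) IH.
by case: (single _); rewrite ?muln1 ?muln0.
Qed.
End OrnamentMonomial.

(** * Flag Eulerian and complete homogeneous functions as coefficients *)

Section Specialisation.
Variable N : nat.
Let MP := {mpoly int[N]}.
Let xM (v : 'I_N) : MP := 'X_v.
Let x2 (v : 'I_N) : {poly {poly MP}} := (xM v)%:P%:P.

Lemma mpoly_mulrn_eq0 (a : MP) k : a *+ k.+1 = 0 -> a = 0.
Proof.
move=> /mpolyP E; apply/mpolyP => m; have := E m.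
by rewrite mcoeffMn !mcoeff0 => /eqP; rewrite Num.Theory.mulrn_eq0 => /eqP.
Qed.

Lemma poly_mulrn_eq0 (R : nzRingType) :
  (forall (a : R) k, a *+ k.+1 = 0 -> a = 0) ->
  forall (p : {poly R}) k, p *+ k.+1 = 0 -> p = 0.
Proof.
move=> Rtf p k E; apply/polyP => i; rewrite coef0; apply: (Rtf _ k).
by rewrite -coefMn E coef0.
Qed.

(** The nested coefficients fix, from the inside out, the number of letters, the exponent [jstat] of
    [r] and the exponent [kstat] of [t]. *)
Lemma coef_Qflag l m k j :
  (ornament_series l m x2 'X%:P 'X)`_m`_j`_k = Qflag N l m k j.
Proof.
rewrite coef_ornament_series.
rewrite coef_sum.
rewrite coef_sum.
rewrite /Qflag [RHS]big_mkcond.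
rewrite [LHS]big_mkcond.
apply: eq_bigr => Q _; rewrite [in RHS]andbA; case: ifP => //= _.
rewrite (statmon_ornament xM Q).
rewrite coefMC coefXn mulr_natl coefMn coefXnM coefC.
rewrite [j == _]eq_sym andbC; case: (jstat Q == j) => /=; rewrite ?mulr0n ?mulr1n //.
by rewrite subn_eq0; case: ltngtP.
Qed.

(** Multiplying out gives the monomials with all exponents at most [n]; in degree [k <= n] these are
    all monomials. *)
Lemma coef_hser n k : (k <= n)%N -> (hser n xM 1)`_k = hcomp N k.
Proof.
move=> kn; rewrite /hser /geom bigA_distr_bigA coef_sum /hcomp.
pose expo (f : {ffun 'I_N -> 'I_n.+1}) := [multinom (f v : nat) | v < N].
have expoE f v : expo f v = f v by rewrite mnmE.
have termE (f : {ffun 'I_N -> 'I_n.+1}) :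
    \prod_v ((1 * xM v) *: 'X^1) ^+ f v = 'X_[expo f] *: 'X^(mdeg (expo f)) :> {poly MP}.
  rewrite mpolyXE_id mdegE.
  elim: (index_enum _) => [|v s IH]; first by rewrite !big_nil expr0 scale1r.
  by rewrite !big_cons IH !expoE mul1r exprZn -scalerAl -scalerAr scalerA expr1 exprD.
under eq_bigr => f _ do rewrite termE coefZ coefXn.
rewrite (bigID (fun f : {ffun 'I_N -> 'I_n.+1} => mdeg (expo f) == k)) /=.
rewrite [X in _ + X]big1 ?addr0; last first.
  by move=> f /negPf; rewrite eq_sym => ->; rewrite mulr0.
rewrite (reindex_omap (fun m : 'X_{1..N < k.+1} => [ffun v => inord (m v)])
  (fun f : {ffun 'I_N -> 'I_n.+1} => insub (expo f))) /=; last first.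
  move=> f /eqP fk; rewrite insubT ?fk // => fk1 /=; congr Some.
  by apply/ffunP => v; rewrite ffunE /= expoE inord_val.
have expoK (m : 'X_{1..N < k.+1}) : expo [ffun v => inord (m v)] = m.
  apply/mnmP => v; rewrite expoE ffunE inordK // ltnS (leq_trans _ kn) //.
  by rewrite -ltnS (leq_ltn_trans _ (bmdeg m)) // mdegE (bigD1 v) //= leq_addr.
apply: eq_big => [m|m]; rewrite expoK; first by rewrite valK eqxx andbT.
by case/andP=> /eqP -> _; rewrite eqxx mulr1.
Qed.

End Specialisation.

(** * Symmetry of the coefficients of powers of r *)

Section GenericSymmetry.
Variables (A : idomainType) (N l n : nat) (x : 'I_N -> A).
Hypothesis l_gt0 : (0 < l)%N.
Hypothesis Atf : forall (a : A) k, a *+ k.+1 = 0 -> a = 0.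
Let xP : 'I_N -> {poly A} := polyC \o x.
Let xPP : 'I_N -> {poly {poly A}} := fun v => (x v)%:P%:P.
Let h j := (hser n x 1)`_j.
Let D : {poly {poly A}} := tdet l xP 'X.
Let F := hser n xPP 1 * ornament_series l n xPP 'X%:P 'X.
(** The coefficient of [r^j] in [F], as a truncated series in [z] over the polynomials in [t]. *)
Let Fr j : {poly {poly A}} := \poly_(k < n.+1) F`_k`_j.

(** In [hser_ornament_det] only [F] and [H(rz)] involve [r], and the coefficient of [r^j] in [H(rz)]
    is [h_j z^j]. *)
Lemma coef_Fr_tdet j :
  eqmodX n (Fr j * D) (elin xP ('X^l) * ((h j)%:P *: 'X^j)).
Proof.
have tD : tdet l xPP 'X%:P = map_poly polyC D.
  by rewrite (map_tdet (polyC : {rmorphism {poly A} -> {poly {poly A}}})).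
have tE : elin xPP ('X%:P ^+ l) = map_poly polyC (elin xP ('X^l)).
  by rewrite (map_elin (polyC : {rmorphism {poly A} -> {poly {poly A}}})) -rmorphXn.
have tH k : (hser n xPP 'X)`_k = 'X^k * (h k)%:P%:P.
  rewrite hser_dilated; congr (_ * _).
  rewrite -[xPP]/(polyC \o (polyC \o x)) -[1]/(1%:P%:P).
  rewrite -(map_hser (polyC : {rmorphism {poly A} -> {poly {poly A}}})).
  by rewrite -(map_hser (polyC : {rmorphism A -> {poly A}})) !coef_map.
have FD : eqmodX n (F * map_poly polyC D) (map_poly polyC (elin xP ('X^l)) * hser n xPP 'X).
  rewrite -tD -tE; apply: hser_ornament_det => //.
  by apply/poly_mulrn_eq0/poly_mulrn_eq0.
move=> k kn; have := FD k kn; rewrite [LHS]coefM [RHS]coefM.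
move/(congr1 (fun p : {poly {poly A}} => p`_j)); rewrite [LHS]coef_sum [RHS]coef_sum => E.
rewrite [LHS]coefM [RHS]coefM.
transitivity (\sum_(i < k.+1) (F`_i * (map_poly polyC D)`_(k - i))`_j).
  apply: eq_bigr => i _; rewrite coef_poly ltnS (leq_trans (leq_ord i) kn).
  by rewrite coef_map coefMC.
rewrite E; apply: eq_bigr => i _.
rewrite tH coef_map coefCM coefMC coefXn coefZ coefXn [j == _]eq_sym.
by case: eqP => [->|_]; rewrite ?(mul0r, mulr0) // mul1r mulr1.
Qed.

(** The series [Fr j] and [h_j z^j] times [Fr 0] agree after multiplication by [D], which has
    constant term 1 and so can be cancelled. *)
Lemma coef_Fr j k : (j <= k <= n)%N -> F`_k`_j = (h j)%:P * (Fr 0)`_(k - j).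
Proof.
case/andP=> jk kn.
have h0 : h 0 = 1.
  have := @elin_hser _ _ n x 1 0 isT; rewrite coef0M elin_coef0 mul1r coef1; exact.
have : eqmodX n (Fr j) (Fr 0 * ((h j)%:P *: 'X^j)).
  apply: (@eqmodX_cancelr _ _ _ _ D); first exact: tdet_coef0.
  rewrite mulrAC; apply: (eqmodX_trans (coef_Fr_tdet j)).
  apply: eqmodX_sym; apply: (eqmodX_trans (eqmodXMr _ (coef_Fr_tdet 0))).
  by rewrite h0 expr0 scale1r mulr1.
move/(_ k kn); rewrite coef_poly ltnS kn => ->.
by rewrite -scalerAr coefZ coefMXn ltnNge jk.
Qed.

Lemma hser_ornament_symmetry a b j : (a + b + 1 = l * (n - j))%N ->
  F`_n`_j`_a = F`_n`_j`_b.
Proof.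
(* For [n < j] the truncated difference [n - j] is 0, which contradicts [ab]. *)
move=> ab; have [jn|nj] := leqP j n; last by move: ab; rewrite (eqnP (ltnW nj : n - j == 0)%N); lia.
rewrite coef_Fr ?jn ?leqnn // !coefCM; congr (_ * _).
have F0D : eqmodX n (Fr 0 * D) (elin xP ('X^l)).
  apply: (eqmodX_trans (coef_Fr_tdet 0)).
  have := @elin_hser _ _ n x 1 0 isT; rewrite coef0M elin_coef0 mul1r coef1 => h0.
  by rewrite /h h0 expr0 scale1r mulr1.
have nj : (0 < n - j)%N by move: ab; case: (n - j)%N => //; lia.
(* With [k = n - j], mirroring sends the exponent [a] to [lk - a = b + 1] in ['X * G], that is to
   [b] in [G], where [G] is [Fr 0]. *)
rewrite (mirror_quotient l_gt0 F0D) ?nj ?leq_subr // -ab.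
have -> : (a <= a + b + 1)%N by lia.
have -> : (a + b + 1 - a = b.+1)%N by lia.
by rewrite coefXM.
Qed.
End GenericSymmetry.

Theorem theorem1p1 (l a b j n : nat) :
  (0 < l)%N -> (1 <= a)%N -> (1 <= b)%N -> (1 <= n)%N ->
  (a + b + 1 = l * (n - j))%N ->
  forall N : nat,
    \sum_(i < n.+1) hcomp N i * Qflag N l (n - i) a j
    = \sum_(i < n.+1) hcomp N i * Qflag N l (n - i) b j.
Proof.
move=> l0 _ _ _ ab N.
pose xM (v : 'I_N) : {mpoly int[N]} := 'X_v.
pose xPP (v : 'I_N) := (xM v)%:P%:P.
suff E c : \sum_(i < n.+1) hcomp N i * Qflag N l (n - i) c j =
    (hser n xPP 1 * ornament_series l n xPP 'X%:P 'X)`_n`_j`_c.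
  by rewrite !E; apply: hser_ornament_symmetry => //; apply: mpoly_mulrn_eq0.
rewrite coefM coef_sum coef_sum; apply: eq_bigr => i _.
have -> : (hser n xPP 1)`_i = (hcomp N i)%:P%:P.
  rewrite -[xPP]/(polyC \o (polyC \o xM)) -[1]/(1%:P%:P).
  rewrite -(map_hser (polyC : {rmorphism {poly {mpoly int[N]}} -> {poly {poly {mpoly int[N]}}}})).
  rewrite -(map_hser (polyC : {rmorphism {mpoly int[N]} -> {poly {mpoly int[N]}}})).
  by rewrite !coef_map coef_hser // leq_ord.
rewrite coefCM coefCM; congr (_ * _).
(* [Qflag] at [n - i] is built on words of length at most [n - i], so the series is first cut down
   to that bound. *)
rewrite ornament_series_le ?leq_subr //; first by rewrite coef_Qflag.
exact/poly_mulrn_eq0/poly_mulrn_eq0/mpoly_mulrn_eq0.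
Qed.
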